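(* Let $n\ge 2$ be an integer. Let $\mathfrak{A}$ and $\mathfrak{A}'$ be two alternative $*$-algebras with identities $1_{\mathfrak{A}}$ and $1_{\mathfrak{A}'}$, respectively, and let $e_1$ and $e_2=1_{\mathfrak{A}}-e_1$ be nontrivial symmetric idempotents in $\mathfrak{A}$. Let $\varphi:\mathfrak{A}\to\mathfrak{A}'$ be a bijective unital map (not assumed additive). Suppose that for each $i\in\{1,2\}$: for $x\in\mathfrak{A}$, $x(\mathfrak{A}e_i)=\{0\}$ implies $x=0$; and for $y\in\mathfrak{A}'$, $y(\mathfrak{A}'\varphi(e_i))=\{0\}$ implies $y=0$. If $$\varphi(q_{n*}(\xi,\ldots,\xi,a,b))=q_{n*}(\varphi(\xi),\ldots,\varphi(\xi),\varphi(a),\varphi(b))$$ for all $a,b\in\mathfrak{A}$ and all $\xi\in\{1_{\mathfrak{A}},e_1,e_2\}$, then $\varphi$ is a $*$-ring isomorphism.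
   Context: The ground field is $\mathbb{C}$. An alternative $*$-algebra is a complex (not necessarily associative) algebra satisfying $x(xy)=x^2y$ and $(yx)x=yx^2$, equipped with an involution $*$ (conjugate-linear, $(ab)^*=b^*a^*$, $a^{**}=a$). An idempotent $e$ is symmetric if $e^*=e$ and nontrivial if $e\ne 0$ and $e\neq 1_{\mathfrak{A}}$. Unital means $\varphi(1_{\mathfrak{A}})=1_{\mathfrak{A}'}$. Write $\{x,y\}_*=xy+yx^*$ and define $q_{1*}(x)=x$ and $q_{n*}(x_1,\ldots,x_n)=\{q_{(n-1)*}(x_1,\ldots,x_{n-1}),x_n\}_*$ for $n\ge2$. In $q_{n*}(\xi,\ldots,\xi,a,b)$ the element $\xi$ occurs $n-2$ times. $\mathfrak{A}e_i=\{ae_i: a\in\mathfrak{A}\}$ and $\mathfrak{A}'\varphi(e_i)=\{a'\varphi(e_i):a'\in\mathfrak{A}'\}$. A $*$-ring isomorphism is a bijection that is additive, multiplicative and satisfies $\varphi(a^* )=\varphi(a)^*$. *)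

(* Defs.v *)
From HB Require Import structures.
From mathcomp Require Import all_boot all_order all_algebra.
From mathcomp Require Import reals complex.

Set Implicit Arguments.
Unset Strict Implicit.
Unset Printing Implicit Defensive.

Import GRing.Theory Num.Theory.
Local Open Scope ring_scope.

Reserved Notation "x ** y" (at level 40, left associativity).

(* The product is not assumed associative, so the ring structures of ssralg do
   not apply: only the underlying complex vector space is taken from there.
   [aone] is not required to differ from [0]. *)
HB.mixin Record Lmodule_isAltStarAlgebra (R : realType) A
    of GRing.Lmodule R[i] A := {
  amul : A -> A -> A;
  aone : A;
  star : A -> A;
  amulDl : left_distributive amul +%R;
  amulDr : right_distributive amul +%R;
  amulZl : forall (c : R[i]) (x y : A), amul (c *: x) y = c *: amul x y;
  amulZr : forall (c : R[i]) (x y : A), amul x (c *: y) = c *: amul x y;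
  amul1x : left_id aone amul;
  amulx1 : right_id aone amul;
  amul_altl : forall x y : A, amul x (amul x y) = amul (amul x x) y;
  amul_altr : forall x y : A, amul (amul y x) x = amul y (amul x x);
  starD : {morph star : x y / x + y};
  starZ : forall (c : R[i]) (x : A), star (c *: x) = c^* *: star x;
  starM : forall x y : A, star (amul x y) = amul (star y) (star x);
  starK : involutive star
}.

#[short(type="altStarAlgType")]
HB.structure Definition AltStarAlgebra (R : realType) :=
  {A of GRing.Lmodule R[i] A & Lmodule_isAltStarAlgebra R A}.

Notation "x ** y" := (amul x y) : ring_scope.

Section AltStarAlgebraDefs.
Variables (R : realType) (A : altStarAlgType R).
Implicit Types (x y e : A) (s : seq A).

Definition symmetric_idempotent e : Prop := e ** e = e /\ star e = e.

Definition nontrivial_symmetric_idempotent e : Prop :=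
  [/\ symmetric_idempotent e, e <> 0 & e <> aone].

(* {x, y}_* *)
Definition jstar x y : A := x ** y + y ** star x.

(* q_{n*}(x_1, ..., x_n) is [qstar [:: x_1; ...; x_n]], the arity n being the
   length of the list; the value on the empty list is a dummy. *)
Definition qstar s : A := if s is x :: s' then foldl jstar x s' else 0.

Lemma qstar1 x : qstar [:: x] = x.
Proof. by []. Qed.

Lemma qstar_rcons s x : s != [::] -> qstar (rcons s x) = jstar (qstar s) x.
Proof. by case: s => // y s _; rewrite /= foldl_rcons. Qed.

(* x (A e) = {0} implies x = 0 *)
Definition left_faithful_on e : Prop :=
  forall x, (forall a : A, x ** (a ** e) = 0) -> x = 0.

End AltStarAlgebraDefs.

(* Ring isomorphism: additivity and multiplicativity only, no C-linearity. *)
Definition star_ring_isomorphism (R : realType) (A A' : altStarAlgType R)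
    (phi : A -> A') : Prop :=
  [/\ bijective phi,
      {morph phi : x y / x + y},
      {morph phi : x y / x ** y} &
      {morph phi : x / star x}].

(* Main.v *)
Require Import Defs.
From mathcomp Require Import all_boot all_order all_algebra.
From mathcomp Require Import reals complex.

Local Open Scope ring_scope.
Import GRing.Theory Num.Theory.

Set Implicit Arguments.
Unset Strict Implicit.

(** Write {x, y} for [jstar x y], k for [2 ^ (n - 2)], [e] for [e1], and let
    A = A11 + A12 + A21 + A22 be the Peirce decomposition for [e] and [1 - e].
    With xi = 1 the hypothesis reads
      phi (k {x, y}) = k {phi x, phi y}.                                (1)

    Additivity. The bracket is biadditive, so if phi t = phi x + phi y, then
    (1) shows that phi (k {t, c}) is also the sum of phi (k {x, c}) and
    phi (k {y, c}), and likewise for {c, t}: an equation between images can be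
    pushed through brackets ([splits]). The double bracket {e, {y, 1 - e}}
    equals y12 + y12^* ([jstar_idem_corner]). Choosing t and s with
    phi t = phi e + phi u and phi s = phi (1 - e) + phi v for u, v in A12, a few
    such brackets determine t and s well enough to see that the 12-corner of
    {t, s} is u + v ([splits_corner_bracket]); this makes phi additive on the
    elements w + w^* with w in A12 ([phi_hsumD]). If now phi t = phi x + phi y
    with x and y arbitrary, every test that produces such elements takes the
    same value at t and at x + y, and these tests separate points because A is
    faithful on both idempotents ([corners_separate]); so t = x + y.

    Multiplicativity. Once phi is additive, the factor k cancels, and
    {x, 1} = x + x^* shows that phi commutes with the involution. As {i x, y} is
    i times x y - y x^*, the product x y is recovered from {x, y} and {i x, y},
    and it suffices that phi (i x) = j phi x for j = phi (i 1) with j central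
    and j j = -1. From {i, y} = 0 the element j commutes with everything, hence
    it also associates with everything ([commuting_nucleus]). The map sending y
    to {i e, y} squares to minus the identity on A12 + A21; transporting this
    gives j j = -1 on the off-diagonal part of A', and faithfulness of A'
    spreads it to the whole algebra ([phi_i_sqr]). *)

(** * Elementary identities in an alternative *-algebra *)

Section Alt.
Context {R : realType} {A : altStarAlgType R}.
Implicit Types x y z c : A.

Lemma lmulIn (m : nat) x y : (0 < m)%N -> x *+ m = y *+ m -> x = y.
Proof.
move=> m0; rewrite -[x *+ m]scaler_nat -[y *+ m]scaler_nat => /eqP.
rewrite -subr_eq0 -scalerBr.
by rewrite scaler_eq0 pnatr_eq0 -[m == 0]negbK -lt0n m0 subr_eq0 => /eqP.
Qed.

Lemma lmuln_eq0 (m : nat) x : (0 < m)%N -> x *+ m = 0 -> x = 0.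
Proof. by move=> m0 h; apply: (@lmulIn m) => //; rewrite h mul0rn. Qed.

Lemma amul0l x : 0 ** x = 0.
Proof. by apply: (@addIr _ (0 ** x)); rewrite -amulDl !add0r. Qed.
Lemma amul0r x : x ** 0 = 0.
Proof. by apply: (@addIr _ (x ** 0)); rewrite -amulDr !add0r. Qed.
Lemma amulNl x y : (- x) ** y = - (x ** y).
Proof. by apply: (@addIr _ (x ** y)); rewrite -amulDl !addNr amul0l. Qed.
Lemma amulNr x y : x ** (- y) = - (x ** y).
Proof. by apply: (@addIr _ (x ** y)); rewrite -amulDr !addNr amul0r. Qed.
Lemma amulBl x y z : (x - y) ** z = x ** z - y ** z.
Proof. by rewrite amulDl amulNl. Qed.
Lemma amulBr x y z : z ** (x - y) = z ** x - z ** y.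
Proof. by rewrite amulDr amulNr. Qed.
Lemma amulMnl x y m : (x *+ m) ** y = (x ** y) *+ m.
Proof. by elim: m => [|m IH]; rewrite ?amul0l // !mulrS amulDl IH. Qed.
Lemma amulMnr x y m : x ** (y *+ m) = (x ** y) *+ m.
Proof. by elim: m => [|m IH]; rewrite ?amul0r // !mulrS amulDr IH. Qed.
Lemma star0 : star (0 : A) = 0.
Proof. by apply: (@addIr _ (star (0 : A))); rewrite -starD !add0r. Qed.
Lemma starN x : star (- x) = - star x.
Proof. by apply: (@addIr _ (star x)); rewrite -starD !addNr star0. Qed.
Lemma starB x y : star (x - y) = star x - star y.
Proof. by rewrite starD starN. Qed.
Lemma starMn x m : star (x *+ m) = star x *+ m.
Proof. by elim: m => [|m IH]; rewrite ?star0 // !mulrS starD IH. Qed.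
Lemma star1 : star (aone : A) = aone.
Proof. by rewrite -[LHS]amulx1 -{2}[aone]starK -starM amulx1 starK. Qed.

Lemma jstarDl x y z : jstar (x + y) z = jstar x z + jstar y z.
Proof. by rewrite /jstar starD amulDl amulDr addrACA. Qed.
Lemma jstarDr x y z : jstar z (x + y) = jstar z x + jstar z y.
Proof. by rewrite /jstar amulDl amulDr addrACA. Qed.
Lemma jstarMnl x y m : jstar (x *+ m) y = jstar x y *+ m.
Proof. by rewrite /jstar starMn amulMnl amulMnr mulrnDl. Qed.
Lemma jstarMnr x y m : jstar x (y *+ m) = jstar x y *+ m.
Proof. by rewrite /jstar amulMnl amulMnr mulrnDl. Qed.
Lemma jstar0l x : jstar 0 x = 0.
Proof. by rewrite /jstar star0 amul0l amul0r addr0. Qed.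
Lemma jstar0r x : jstar x 0 = 0.
Proof. by rewrite /jstar amul0l amul0r addr0. Qed.
Lemma jstar1l x : jstar aone x = x *+ 2.
Proof. by rewrite /jstar star1 amul1x amulx1 mulr2n. Qed.
Lemma jstar1r x : jstar x aone = x + star x.
Proof. by rewrite /jstar amulx1 amul1x. Qed.

Definition associator x y z := (x ** y) ** z - x ** (y ** z).

(** Linearizing the left alternative law: the associator is alternating in its
    first two arguments, and by [associatorC23] in its last two. *)
Lemma associatorC12 x y z : associator y x z = - associator x y z.
Proof.
have := amul_altl (x + y) z.
rewrite !amulDl !amulDr !amul_altl !amulDl -!addrA => /addrI.
rewrite !addrA => /addIr h.
rewrite /associator opprB; apply/eqP.
by rewrite subr_eq addrAC eq_sym subr_eq h addrC.
Qed.

Lemma associatorC23 x y z : associator x z y = - associator x y z.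
Proof.
have := amul_altr (y + z) x.
rewrite !amulDr !amulDl !amul_altr !amulDr -!addrA => /addrI.
rewrite !addrA => /addIr h.
rewrite /associator opprB; apply/eqP.
by rewrite subr_eq addrAC eq_sym subr_eq [eqbLHS]addrC -h.
Qed.

Lemma flexible x y : (x ** y) ** x = x ** (y ** x).
Proof.
apply/eqP; rewrite -subr_eq0; apply/eqP; rewrite -/(associator x y x).
by rewrite associatorC12 /associator amul_altr subrr oppr0.
Qed.

(** For commuting [c], expanding the associators gives
    (x, y, c) + (c, x, y) = (x, c, y), which by alternation means
    3 (x, y, c) = 0. *)
Lemma commuting_nucleus c : (forall x, c ** x = x ** c) ->
  forall x y, associator x y c = 0.
Proof.
move=> cC x y; apply: (@lmuln_eq0 3) => //.
have h : associator x y c + associator c x y = associator x c y.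
  by rewrite /associator (cC (x ** y)) (cC x) (cC y) addrC addrA subrK.
move: h; rewrite (associatorC12 x c) (associatorC23 x y c) opprK => /eqP.
by rewrite -subr_eq0 opprK => /eqP; rewrite !mulrS mulr0n addr0 addrA.
Qed.

(** * Peirce decomposition *)

Section Peirce.
Variable e : A.
Hypothesis e_sym : symmetric_idempotent e.

(** A boolean index makes [negb] exchange the two idempotents, so that every
    statement about one of them covers the other as well. *)
Definition idem (a : bool) : A := if a then e else aone - e.
Local Notation E := idem.

Lemma idem_split : E true + E false = aone.
Proof. by rewrite addrC subrK. Qed.
Lemma idemN a : E (~~ a) = aone - E a.
Proof. by case: a => //=; rewrite subKr. Qed.
Lemma idem_idem a : E a ** E a = E a.
Proof.
case: e_sym => ee _; case: a => //=.
by rewrite amulBl !amulBr amul1x amulx1 amul1x ee subrr subr0.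
Qed.
Lemma star_idem a : star (E a) = E a.
Proof. by case: e_sym => _ es; case: a => //=; rewrite starB star1 es. Qed.

Lemma idem_mull a x : E a ** (E a ** x) = E a ** x.
Proof. by rewrite amul_altl idem_idem. Qed.
Lemma idem_mulr a x : (x ** E a) ** E a = x ** E a.
Proof. by rewrite amul_altr idem_idem. Qed.
Lemma idemN_mull a x : E a ** (E (~~ a) ** x) = 0.
Proof. by rewrite idemN amulBl amul1x amulBr idem_mull subrr. Qed.
Lemma idemN_mulr a x : (x ** E (~~ a)) ** E a = 0.
Proof. by rewrite idemN amulBr amulx1 amulBl idem_mulr subrr. Qed.
Lemma idem_mulA a b x : (E a ** x) ** E b = E a ** (x ** E b).
Proof.
case: (eqVneq b a) => [->|]; first exact: flexible.
case: a b => -[] // _; rewrite /= -/(E true);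
by rewrite ?(amulBr, amulBl, amulx1, amul1x) ?flexible.
Qed.

Definition peirce_proj a b x := (E a ** x) ** E b.

Local Notation proj := peirce_proj.

Lemma projD a b x y : proj a b (x + y) = proj a b x + proj a b y.
Proof. by rewrite /peirce_proj amulDr amulDl. Qed.
Lemma proj0 a b : proj a b 0 = 0.
Proof. by rewrite /peirce_proj amul0r amul0l. Qed.
Lemma projB a b x y : proj a b (x - y) = proj a b x - proj a b y.
Proof. by rewrite /peirce_proj amulBr amulBl. Qed.
Lemma projMn a b x m : proj a b (x *+ m) = proj a b x *+ m.
Proof. by rewrite /peirce_proj amulMnr amulMnl. Qed.
Lemma proj_star a b x : proj a b (star x) = star (proj b a x).
Proof. by rewrite /peirce_proj !starM !star_idem idem_mulA. Qed.

Lemma idem_proj i a b x : E i ** proj a b x = proj a b x *+ (i == a).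
Proof.
rewrite /peirce_proj idem_mulA; case: (eqVneq i a) => [->|].
  exact: idem_mull.
by case: i a => -[] // _; exact: idemN_mull.
Qed.
Lemma proj_idem j a b x : proj a b x ** E j = proj a b x *+ (j == b).
Proof.
rewrite /peirce_proj; case: (eqVneq j b) => [->|]; first exact: idem_mulr.
case: j b => -[] // _; first exact: (idemN_mulr true).
exact: (idemN_mulr false).
Qed.
Lemma proj_proj i j a b x :
  proj i j (proj a b x) = proj a b x *+ ((i == a) && (j == b)).
Proof.
rewrite {1}/peirce_proj idem_proj amulMnl proj_idem.
by case: (i == a); case: (j == b).
Qed.
Lemma proj_sum x :
  x = proj true true x + proj true false x + proj false true x
    + proj false false x.
Proof.
by rewrite /peirce_proj -amulDr idem_split amulx1 -addrA -amulDr idem_split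
  amulx1 -amulDl idem_split amul1x.
Qed.

(** The product w of x_ij and y_kl is an eigenvector of multiplication by e on
    both sides, of eigenvalues i + j - k on the left and k + l - j on the right:
    as e acts on x_ij and y_kl by scalars, the associators (e, x, y), (x, e, y)
    and (x, y, e) are combinations of w, e w and w e, and alternation equates
    them up to sign. *)
Lemma idem_mul_proj i j k l x y (w := proj i j x ** proj k l y) :
  E true ** w + w *+ k = w *+ (i + j) /\ w ** E true + w *+ j = w *+ (k + l).
Proof.
set u := proj i j x in w *; set v := proj k l y in w *.
have eu : E true ** u = u *+ i by rewrite idem_proj eq_sym eqb_id.
have ue : u ** E true = u *+ j by rewrite proj_idem eq_sym eqb_id.
have ev : E true ** v = v *+ k by rewrite idem_proj eq_sym eqb_id.
have ve : v ** E true = v *+ l by rewrite proj_idem eq_sym eqb_id.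
have h1 := associatorC12 (E true) u v; have h2 := associatorC23 u (E true) v.
have {h1} : associator (E true) u v = w *+ k - w *+ j.
  by rewrite -[LHS]opprK -h1 /associator ue ev amulMnl amulMnr opprB.
have {h2} : associator u v (E true) = w *+ k - w *+ j.
  by rewrite h2 /associator ue ev amulMnl amulMnr opprB.
rewrite /associator eu ve amulMnl amulMnr -/w => /eqP h1 /eqP h2; split.
  apply/eqP; rewrite mulrnDr -subr_eq -addrA eq_sym addrC eq_sym.
  by move: h2; rewrite subr_eq -addrA [_ + E true ** w]addrC => /eqP ->.
by move: h1; rewrite subr_eq => /eqP ->; rewrite mulrnDr addrAC subrK.
Qed.

End Peirce.
End Alt.

Section PeirceProducts.
Context {R : realType} {A : altStarAlgType R}.
Implicit Types x y z c : A.
Variable e : A.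
Hypothesis e_sym : symmetric_idempotent e.
Local Notation E := (idem e).
Local Notation proj := (peirce_proj e).

Lemma proj_eigen (i l : bool) w :
  E true ** w = w *+ i -> w ** E true = w *+ l ->
  forall a b : bool, proj a b w = w *+ ((a == i) && (b == l)).
Proof.
move=> el er a b.
have ha : E a ** w = w *+ (a == i).
  case: a => /=; first by rewrite [e ** w]el; case: (i).
  by rewrite amulBl amul1x [e ** w]el; case: (i) => /=; rewrite ?subrr ?subr0.
rewrite /peirce_proj ha amulMnl.
suff -> : w ** E b = w *+ (b == l) by case: (a == i); case: (b == l).
case: b => /=; first by rewrite [w ** e]er; case: (l).
by rewrite amulBr amulx1 [w ** e]er; case: (l) => /=; rewrite ?subrr ?subr0.
Qed.

(** Multiplication by an idempotent has no eigenvalue other than 0 and 1. *)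
Lemma idem_mull_eq0 w : E true ** w = w *+ 2 \/ E true ** w = - w -> w = 0.
Proof.
have := idem_mull e_sym true w => h [] ew; move: h; rewrite ew.
  rewrite amulMnr ew -mulrnA => h; apply: (@lmuln_eq0 _ _ 2) => //.
  by apply: (@addIr _ (w *+ 2)); rewrite add0r -mulrnDr.
rewrite amulNr ew opprK => h; apply: (@lmuln_eq0 _ _ 2) => //.
by rewrite mulr2n {1}h addNr.
Qed.

Lemma idem_mulr_eq0 w : w ** E true = w *+ 2 \/ w ** E true = - w -> w = 0.
Proof.
have := idem_mulr e_sym true w => h [] ew; move: h; rewrite ew.
  rewrite amulMnl ew -mulrnA => h; apply: (@lmuln_eq0 _ _ 2) => //.
  by apply: (@addIr _ (w *+ 2)); rewrite add0r -mulrnDr.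
rewrite amulNl ew opprK => h; apply: (@lmuln_eq0 _ _ 2) => //.
by rewrite mulr2n {1}h addNr.
Qed.

(** Peirce multiplication rules. The eigenvalues of [idem_mul_proj] are those of
    A_il when j = k. When j <> k they lie in {0, 1} only for
    A_ij A_ij with i <> j, which lands in A_ji; this last product is nonzero in
    general, unlike in an associative algebra. *)
Lemma proj_mul_proj a b i j k l x y :
  proj a b (proj i j x ** proj k l y) =
  (proj i j x ** proj k l y) *+
    (if j == k then (a == i) && (b == l)
     else [&& i == k, j == l, a == j & b == i]).
Proof.
have [] := idem_mul_proj e_sym i j k l x y.
set w := proj i j x ** proj k l y => h1 h2.
case: (eqVneq j k) => [jk|jk].
  rewrite -jk mulrnDr in h1; rewrite jk mulrnDr addrC in h2.
  by apply: proj_eigen; [exact: addIr h1 | exact: addrI h2].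
case: (eqVneq i k) => [ik|ik] /=; last first.
  suff -> : w = 0 by rewrite proj0 mul0rn.
  apply: idem_mull_eq0.
  have ij : i = j by case: (i) (j) (k) jk ik => -[] [].
  have kj : k = ~~ j by case: (k) (j) jk => -[].
  move: h1; rewrite ij kj; case: (j) => /= h1.
    by left; rewrite -h1 addr0.
  by right; apply: (@addIr _ w); rewrite [LHS]h1 addNr.
case: (eqVneq j l) => [jl|jl] /=; last first.
  suff -> : w = 0 by rewrite proj0 mul0rn.
  apply: idem_mulr_eq0.
  have lk : l = k by case: (l) (j) (k) jk jl => -[] [].
  have kj : k = ~~ j by case: (k) (j) jk => -[].
  move: h2; rewrite lk kj; case: (j) => /= h2.
    by right; apply: (@addIr _ w); rewrite [LHS]h2 addNr.
  by left; rewrite -h2 addr0.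
rewrite -ik mulrnDr addrC in h1; rewrite -ik -jl mulrnDr in h2.
by apply: proj_eigen; [exact: addrI h1 | exact: addIr h2].
Qed.

Lemma proj_mul a b x y : proj a b (x ** y) =
  proj a true x ** proj true b y + proj a false x ** proj false b y
  + (proj b a x ** proj b a y) *+ (a != b).
Proof.
rewrite {1}(proj_sum e x) {1}(proj_sum e y) !amulDl !amulDr !projD.
rewrite !proj_mul_proj.
case: a; case: b; rewrite /= ?mulr0n ?mulr1n ?addr0 ?add0r //.
by rewrite -addrA addrC.
Qed.

(** * Brackets and Peirce corners *)

Definition hsum x := x + star x.

(** The basic test: a double bracket isolates one off-diagonal corner, up to
    adding its adjoint. *)
Lemma jstar_idem_corner a y :
  jstar (E a) (jstar y (E (~~ a))) = hsum (proj a (~~ a) y).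
Proof.
rewrite /jstar !(star_idem e_sym) !amulDr !amulDl (idemN_mull e_sym) addr0.
rewrite (idemN_mulr e_sym) add0r -idem_mulA // /hsum /peirce_proj.
by rewrite !starM !star_idem // !idem_mulA.
Qed.

Lemma proj_hsum a x : proj a (~~ a) (hsum (proj a (~~ a) x)) = proj a (~~ a) x.
Proof.
rewrite /hsum projD proj_star // !proj_proj // !eqxx mulr1n.
by case: a; rewrite /= ?mulr0n star0 addr0.
Qed.

Lemma hsumMn x m : hsum (x *+ m) = hsum x *+ m.
Proof. by rewrite /hsum starMn mulrnDl. Qed.

Lemma proj_jstar a u v : proj a (~~ a) (jstar u v) =
  proj a a u ** proj a (~~ a) v + proj a (~~ a) u ** proj (~~ a) (~~ a) v
  + proj (~~ a) a u ** proj (~~ a) a v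
  + (proj a a v ** star (proj (~~ a) a u)
     + proj a (~~ a) v ** star (proj (~~ a) (~~ a) u)
     + proj (~~ a) a v ** star (proj a (~~ a) u)).
Proof.
rewrite /jstar projD !proj_mul !proj_star //.
by case: a => /=; congr (_ + _); rewrite mulr1n // [X in X + _]addrC.
Qed.

Lemma proj_diag_mul_eq0 a x y : proj a a x ** proj (~~ a) (~~ a) y = 0.
Proof.
rewrite [LHS](proj_sum e) !proj_mul_proj.
by case: a => /=; rewrite !mulr0n !addr0.
Qed.

(** On a diagonal corner x_aa, right factors c e_b with b <> a only see the
    component c_ab, so faithfulness can be tested on A_ab alone. *)
Lemma corner_faithful a x : left_faithful_on (E (~~ a)) ->
  (forall c, proj a a x ** proj a (~~ a) c = 0) -> proj a a x = 0.
Proof.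
move=> faith h; apply: faith => c.
have -> : c ** E (~~ a) = proj a (~~ a) c + proj (~~ a) (~~ a) c.
  rewrite /peirce_proj -amulDl -amulDl.
  case: a {h} => /=; last rewrite [_ + e]addrC.
    by rewrite (idem_split e) amul1x.
  by rewrite (idem_split e) amul1x.
by rewrite amulDr h proj_diag_mul_eq0 addr0.
Qed.

(** For c in A_ba (b <> a) the ab-corner of {c, x} is x_aa c^*, provided the
    off-diagonal part of x vanishes; c^* runs over all of A_ab, hence
    [corner_faithful] applies. *)
Lemma corners_separate x : (forall a, left_faithful_on (E a)) ->
  (forall a, proj a (~~ a) x = 0) ->
  (forall a c, proj a (~~ a) (jstar c x) = 0) -> x = 0.
Proof.
move=> faith off test.
have off' a : proj (~~ a) a x = 0 by rewrite -{2}[a]negbK off.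
have diag a : proj a a x = 0.
  apply: corner_faithful => // c.
  have := test a (star (proj a (~~ a) c)).
  rewrite proj_jstar off off' !proj_star // starK !proj_proj // !eqxx.
  rewrite !amul0l !amul0r.
  by case: a; rewrite /= ?mulr0n ?star0 ?amul0l !add0r !addr0.
rewrite [x](proj_sum e) !diag (off true) (off false).
by rewrite !addr0.
Qed.
End PeirceProducts.

(** * Additivity of maps preserving a multiple of the bracket *)

Section Additivity.
Context {R : realType} {A A' : altStarAlgType R}.
Variables (phi : A -> A') (k : nat) (e : A).
Hypothesis k_gt0 : (0 < k)%N.
Hypothesis phi_inj : injective phi.
Hypothesis phi_surj : forall y, exists x, phi x = y.
Hypothesis phi_jstar : forall x y,
  phi (jstar x y *+ k) = jstar (phi x) (phi y) *+ k.
Hypothesis e_sym : symmetric_idempotent e.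
Implicit Types t x y c : A.
Local Notation E := (idem e).
Local Notation proj := (peirce_proj e).

Lemma bracket_map0 : phi 0 = 0.
Proof.
have [z z0] := phi_surj 0.
by rewrite -[X in phi X](mul0rn _ k) -(jstar0l z) phi_jstar z0 jstar0r mul0rn.
Qed.

(** Relation between preimages of a sum; it is stable under the operations
    k {., c} and k {c, .} by biadditivity, which is how information on [t] is
    extracted before phi is known to be additive. *)
Definition splits t x y := phi t = phi x + phi y.

Lemma splitsC t x y : splits t x y -> splits t y x.
Proof. by rewrite /splits addrC. Qed.

Lemma splits_jstarl c t x y : splits t x y ->
  splits (jstar t c *+ k) (jstar x c *+ k) (jstar y c *+ k).
Proof. by rewrite /splits !phi_jstar => ->; rewrite jstarDl mulrnDl. Qed.

Lemma splits_jstarr c t x y : splits t x y ->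
  splits (jstar c t *+ k) (jstar c x *+ k) (jstar c y *+ k).
Proof. by rewrite /splits !phi_jstar => ->; rewrite jstarDr mulrnDl. Qed.

Lemma phi_corner a x : phi (hsum (proj a (~~ a) x) *+ (k * k)) =
  jstar (phi (E a)) (jstar (phi x) (phi (E (~~ a))) *+ k) *+ k.
Proof.
by rewrite -jstar_idem_corner // mulrnA -[X in X *+ k]jstarMnr !phi_jstar.
Qed.

Lemma splits_corner a t x y : splits t x y ->
  splits (hsum (proj a (~~ a) t) *+ (k * k)) (hsum (proj a (~~ a) x) *+ (k * k))
    (hsum (proj a (~~ a) y) *+ (k * k)).
Proof.
rewrite /splits !phi_corner => ->.
by rewrite jstarDl [X in jstar _ X]mulrnDl jstarDr mulrnDl.
Qed.

Lemma hsum_corner_inj a m x y : (0 < m)%N ->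
  hsum (proj a (~~ a) x) *+ m = hsum (proj a (~~ a) y) *+ m ->
  proj a (~~ a) x = proj a (~~ a) y.
Proof.
by move=> m0 /(lmulIn m0) h; rewrite -(proj_hsum e_sym) h proj_hsum.
Qed.

(** If a test kills one of the two summands, injectivity of phi turns the
    equation between images into an equation in A. *)
Lemma splits_proj a t x y : splits t x y -> proj a (~~ a) y = 0 ->
  proj a (~~ a) t = proj a (~~ a) x.
Proof.
move=> /(splits_corner a) + y0; rewrite /splits y0 /hsum star0 addr0.
rewrite mul0rn bracket_map0 addr0 => /phi_inj; apply: hsum_corner_inj.
by rewrite muln_gt0 k_gt0.
Qed.

Lemma splits_proj_jstarl a c t x y : splits t x y ->
  proj a (~~ a) (jstar y c) = 0 ->
  proj a (~~ a) (jstar t c) = proj a (~~ a) (jstar x c).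
Proof.
move=> /(splits_jstarl c)/splits_proj-/(_ a) h y0.
by apply: (lmulIn k_gt0); rewrite -!projMn h // projMn y0 mul0rn.
Qed.

Lemma splits_proj_jstarr a c t x y : splits t x y ->
  proj a (~~ a) (jstar c y) = 0 ->
  proj a (~~ a) (jstar c t) = proj a (~~ a) (jstar c x).
Proof.
move=> /(splits_jstarr c)/splits_proj-/(_ a) h y0.
by apply: (lmulIn k_gt0); rewrite -!projMn h // projMn y0 mul0rn.
Qed.

Lemma proj_E i j a : proj i j (E a) = E a *+ ((i == a) && (j == a)).
Proof.
have -> : E a = proj a a (E a) by rewrite /peirce_proj !idem_idem.
by rewrite proj_proj.
Qed.

(** With (a, b) = (1, 2): the basic tests give t12 = u, s12 = v and
    t21 = s21 = 0. The corner 12 of {t, s} is then t11 v + v t22^* + u s22. As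
    A12 A12 lies in A21 and A12 A21 in A11, the bracket {u, v} has no
    12-corner, so bracketing t with v on the right gives
    t11 v + v t22^* = v, and bracketing s with u on the left gives u s22 = u. *)
Lemma splits_corner_bracket a t s x y
    (u := proj a (~~ a) x) (v := proj a (~~ a) y) :
  splits t (E a) u -> splits s (E (~~ a)) v ->
  [/\ proj a (~~ a) (jstar t s) = u + v,
      proj a (~~ a) s = v & proj a (~~ a) (jstar u s) = u].
Proof.
have uE i j : proj i j u = u *+ ((i == a) && (j == ~~ a)) by exact: proj_proj.
have vE i j : proj i j v = v *+ ((i == a) && (j == ~~ a)) by exact: proj_proj.
have an : (a == ~~ a) = false by case: (a).
have na : (~~ a == a) = false by case: (a).
have uv : proj a (~~ a) (jstar u v) = 0.
  rewrite proj_jstar // !uE !vE !eqxx an na /= !mulr0n.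
  by rewrite ?star0 ?amul0l ?amul0r ?addr0 ?add0r.
move=> tS sS.
have tab : proj a (~~ a) t = u.
  rewrite (splits_proj (splitsC tS)) ?uE ?eqxx //.
  by rewrite proj_E na andbF.
have tba : proj (~~ a) a t = 0.
  have := @splits_proj (~~ a) _ _ _ tS; rewrite negbK => ->.
    by rewrite proj_E na.
  by rewrite uE na.
have sab : proj a (~~ a) s = v.
  rewrite (splits_proj (splitsC sS)) ?vE ?eqxx //.
  by rewrite proj_E an.
have sba : proj (~~ a) a s = 0.
  have := @splits_proj (~~ a) _ _ _ sS; rewrite negbK => ->.
    by rewrite proj_E an andbF.
  by rewrite vE na.
have h1 := splits_proj_jstarl tS uv.
have h2 := splits_proj_jstarr sS uv.
have Ev : proj a (~~ a) (jstar (E a) v) = v.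
  rewrite proj_jstar // !vE !proj_E !eqxx an na /= !mulr0n.
  by rewrite ?star0 ?amul0l ?amul0r ?addr0 ?add0r /v idem_proj // eqxx.
have uE' : proj a (~~ a) (jstar u (E (~~ a))) = u.
  rewrite proj_jstar // !uE !proj_E !eqxx an na /= !mulr0n.
  by rewrite ?star0 ?amul0l ?amul0r ?addr0 ?add0r /u proj_idem // eqxx.
split => //; last by rewrite h2.
move: h1 h2; rewrite Ev uE' !(proj_jstar e_sym) tab tba sab sba !uE !vE.
rewrite !eqxx an na /=.
rewrite ?mulr0n ?star0 ?amul0l ?amul0r ?addr0 ?add0r ?mulr1n => h1 h2.
by rewrite h2 addrAC h1 addrC.
Qed.

Lemma proj_jstar_idem a x :
  proj a (~~ a) (jstar (E a) x) = proj a (~~ a) x.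
Proof.
have na : (~~ a == a) = false by case: (a).
rewrite proj_jstar // !proj_E !eqxx na /= ?mulr0n ?star0 ?amul0l ?amul0r.
by rewrite ?addr0 ?mulr1n idem_proj // eqxx.
Qed.

(** With t and s as in [splits_corner_bracket], the corner 12 of {t, s} splits,
    under phi, into the corners of {e_a, s} and {u, s}, which are v and u. *)
Lemma phi_hsumD a x y (u := proj a (~~ a) x) (v := proj a (~~ a) y) :
  phi (hsum (u + v)) = phi (hsum u) + phi (hsum v).
Proof.
(* One factor k for each of the three brackets used. *)
pose K := (k * (k * k))%N; have K0 : (0 < K)%N by rewrite !muln_gt0 k_gt0.
pose scaled z := K%:R^-1 *: z : A.
have scaledK z : z = scaled z *+ K.
  by rewrite -scaler_nat scalerA divff ?scale1r // pnatr_eq0 -lt0n.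
have key x' y' (u' := proj a (~~ a) x') (v' := proj a (~~ a) y') :
    phi (hsum (u' + v') *+ K) = phi (hsum u' *+ K) + phi (hsum v' *+ K).
  have [t tS] := phi_surj (phi (E a) + phi u').
  have [s sS] := phi_surj (phi (E (~~ a)) + phi v').
  have [bracket vs us] := splits_corner_bracket tS sS.
  have := splits_corner a (splits_jstarl s tS).
  rewrite !projMn bracket proj_jstar_idem us vs.
  by rewrite !hsumMn -!mulrnA /splits [RHS]addrC.
rewrite /u /v (scaledK x) (scaledK y) !projMn -mulrnDl !hsumMn.
exact: key.
Qed.

(** Tests on a corner take values w + w^*, where phi is additive by [phi_hsumD];
    hence they cannot distinguish t from x + y when phi t = phi x + phi y. *)
Lemma bracket_additive : (forall a, left_faithful_on (E a)) ->
  {morph phi : x y / x + y}.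
Proof.
move=> faith x y; have [t tS] := phi_surj (phi x + phi y).
rewrite -tS; congr phi; apply/esym/eqP; rewrite -subr_eq0; apply/eqP.
have off a t' x' y' : splits t' x' y' ->
    proj a (~~ a) t' = proj a (~~ a) (x' + y').
  move=> S; have K0 : (0 < k * k)%N by rewrite muln_gt0 k_gt0.
  apply: (hsum_corner_inj K0); apply: phi_inj; rewrite (splits_corner a S).
  by rewrite -!hsumMn -!projMn mulrnDl projD phi_hsumD.
apply: (corners_separate e_sym) => // a => [|c].
  by rewrite projB (off a _ _ _ tS) subrr.
apply: (lmulIn k_gt0); rewrite mul0rn -projMn -jstarMnr mulrnBl.
have := off a _ _ _ (splits_jstarr c tS).
rewrite -!jstarMnr -jstarDr -mulrnDl => h.
by rewrite jstarDr projD h -projD -jstarDr subrr jstar0r proj0.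
Qed.
End Additivity.

(** * Multiplicativity of additive maps preserving the bracket *)

Section CommutingElement.
Context {R : realType} {A : altStarAlgType R}.
Variable c : A.
Hypothesis cC : forall x, c ** x = x ** c.

Lemma commuting_mulA x y : c ** (x ** y) = (c ** x) ** y.
Proof.
have := commuting_nucleus cC x y.
rewrite -[LHS]opprK -associatorC23 -associatorC12 => /eqP.
by rewrite subr_eq0 => /eqP.
Qed.

Lemma commuting_mulCA x y : x ** (c ** y) = c ** (x ** y).
Proof.
have := commuting_nucleus cC x y.
rewrite -[LHS]opprK -associatorC23 => /eqP.
by rewrite oppr_eq0 subr_eq0 -cC -commuting_mulA => /eqP.
Qed.

Lemma square_commuting x : (c ** c) ** x = x ** (c ** c).
Proof. by rewrite -amul_altl (cC x) -flexible (cC x) amul_altr. Qed.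
End CommutingElement.

Section OffDiagonal.
Context {R : realType} {A : altStarAlgType R}.
Variable e : A.
Hypothesis e_sym : symmetric_idempotent e.

(** The hypothesis says that [x] has no diagonal Peirce part; the commutator
    with [e] then acts as 1 on A12 and as -1 on A21. *)
Lemma commutator_idem_twice x (u := e ** x - x ** e) :
  e ** x + x ** e = x -> e ** u - u ** e = x.
Proof.
move=> ex.
have h : e ** (x ** e) = 0.
  apply: (@addrI _ (e ** (e ** x))).
  by rewrite -amulDr ex addr0 (idem_mull e_sym true).
rewrite /u amulBr amulBl (idem_mull e_sym true) (idem_mulr e_sym true) h.
by rewrite flexible h subr0 sub0r opprK.
Qed.
End OffDiagonal.

Section Multiplicativity.
Context {R : realType} {A A' : altStarAlgType R}.
Variables (phi : A -> A') (e : A).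
Hypothesis phi_inj : injective phi.
Hypothesis phi_surj : forall y, exists x, phi x = y.
Hypothesis phiD : {morph phi : x y / x + y}.
Hypothesis phi1 : phi aone = aone.
Hypothesis phi_jstar : {morph phi : x y / jstar x y}.
Hypothesis e_sym : symmetric_idempotent e.
Hypothesis faith : forall a, left_faithful_on (phi (idem e a)).
Implicit Types x y h : A.

Let phi0 : phi 0 = 0.
Proof. by apply: (@addrI _ (phi 0)); rewrite -phiD !addr0. Qed.
Let phiN x : phi (- x) = - phi x.
Proof. by apply: (@addrI _ (phi x)); rewrite -phiD !subrr. Qed.
Let phiB x y : phi (x - y) = phi x - phi y.
Proof. by rewrite phiD phiN. Qed.

Lemma bracket_star x : phi (star x) = star (phi x).
Proof.
by apply: (@addrI _ (phi x)); rewrite -phiD -!jstar1r phi_jstar phi1.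
Qed.

Lemma phi_symmetric_idempotent : symmetric_idempotent (phi e).
Proof.
have [ee es] := e_sym.
have pes : star (phi e) = phi e by rewrite -bracket_star es.
split=> //; apply: (@lmulIn _ _ 2) => //.
have := phi_jstar e e; rewrite /jstar pes es ee phiD => h.
by rewrite !mulr2n.
Qed.

Lemma phi_idem a : phi (idem e a) = idem (phi e) a.
Proof. by case: a => //=; rewrite phiB phi1. Qed.

Let iota : A := 'i *: aone.
Let j := phi iota.

Let star_iota : star iota = - iota.
Proof. by rewrite /iota starZ conjCi star1 scaleNr. Qed.

(** Image of the relation {i, x} = 0. *)
Lemma phi_i_commutes (y : A') : j ** y = y ** j.
Proof.
have [x <-] := phi_surj y; have := phi_jstar iota x.
rewrite /jstar -/j -bracket_star star_iota phiN -/j amulNr.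
rewrite /iota amulZl amulNr amulZr amul1x amulx1 subrr phi0 => /esym/eqP.
by rewrite subr_eq0 => /eqP.
Qed.
Local Notation jC := phi_i_commutes.

Lemma star_phi_i : star j = - j.
Proof. by rewrite -bracket_star star_iota phiN. Qed.

(** Image of the relation {h, i} = 2 i h. *)
Lemma phi_i_hermitian h : star h = h -> phi ('i *: h) = j ** phi h.
Proof.
move=> hs; apply: (@lmulIn _ _ 2) => //.
have := phi_jstar h iota; rewrite /jstar -bracket_star hs -/j -jC -mulr2n => <-.
by rewrite /iota amulZl amulZr amul1x amulx1 phiD mulr2n.
Qed.

Lemma jstar_i x y : jstar ('i *: x) y = 'i *: (x ** y - y ** star x).
Proof. by rewrite /jstar starZ conjCi amulZl amulZr scaleNr scalerBr. Qed.

Lemma jstar_phi_i (x y : A') : jstar (j ** x) y = j ** (x ** y - y ** star x).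
Proof.
rewrite /jstar starM star_phi_i amulNr -jC amulNr (commuting_mulCA jC).
by rewrite -(commuting_mulA jC) amulBr.
Qed.

(** By [jstar_i] and [jstar_phi_i], the operators {i e, .} on A and
    {j (phi e), .} on A' are i, resp. j, times the commutator with the
    idempotent; phi intertwines them, and applied twice to an off-diagonal
    element they give i i = -1, resp. j j, times that element. *)
Lemma phi_i_sqr_offdiag (w : A') : phi e ** w + w ** phi e = w ->
  (j ** j) ** w = - w.
Proof.
have [_ es] := e_sym; have [_ pes] := phi_symmetric_idempotent.
move=> pw; have [v vw] := phi_surj w.
have ev : e ** v + v ** e = v.
  by apply: phi_inj; rewrite -{2}es -/(jstar e v) phi_jstar vw /jstar pes.
have twice : jstar ('i *: e) (jstar ('i *: e) v) = - v.
  rewrite !jstar_i es amulZl amulZr -scalerBr scalerA -expr2 sqrCi scaleN1r.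
  by rewrite commutator_idem_twice.
rewrite -vw -phiN -twice !phi_jstar phi_i_hermitian // !jstar_phi_i pes vw.
rewrite (commuting_mulCA jC) -[(j ** _) ** phi e](commuting_mulA jC).
rewrite -amulBr amul_altl.
by rewrite commutator_idem_twice //; exact: phi_symmetric_idempotent.
Qed.

(** Let p_a be the images of the two idempotents. The central element
    z = j j + 1 kills every p_a (x p_b) with b <> a, as these elements
    are off-diagonal; so (z p_a) (A' p_b) = 0, and faithfulness gives
    z p_a = 0 for both a. *)
Lemma phi_i_sqr : j ** j = - aone.
Proof.
have pS := phi_symmetric_idempotent.
pose z := j ** j + aone.
have zC (x : A') : z ** x = x ** z.
  by rewrite /z amulDl amulDr amul1x amulx1 square_commuting //; exact: jC.
have zp a : z ** idem (phi e) a = 0.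
  apply: (faith (a := ~~ a)) => x; rewrite phi_idem -commuting_mulA //.
  rewrite -idem_mulA // -/(peirce_proj _ a (~~ a) x) /z amulDl amul1x.
  rewrite phi_i_sqr_offdiag ?addNr //.
  rewrite (idem_proj pS true) (proj_idem pS true).
  by case: (a); rewrite /= ?mulr0n ?addr0 ?add0r.
apply/eqP; rewrite -addr_eq0 -/z -[z]amulx1 -(idem_split (phi e)).
by rewrite amulDr !zp addr0.
Qed.

(** 2 x = h' + i h with h' and h hermitian. On i (i h) = - h the formula of
    [phi_i_hermitian] persists exactly because j j = -1. *)
Lemma phi_i x : phi ('i *: x) = j ** phi x.
Proof.
have jj (y : A') : j ** (j ** y) = - y.
  by rewrite amul_altl phi_i_sqr amulNl amul1x.
apply: (@lmulIn _ _ 2) => //; rewrite !mulr2n -amulDr -!phiD -scalerDr.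
pose h := - ('i *: (x - star x)).
have hs : star h = h.
  by rewrite /h starN starZ conjCi starB starK scaleNr opprK -scalerN opprB.
have ih : 'i *: h = x - star x.
  by rewrite /h scalerN scalerA -expr2 sqrCi scaleN1r opprK.
have -> : x + x = (x + star x) + 'i *: h by rewrite ih addrACA subrr addr0.
rewrite scalerDr (phiD ('i *: _)) (phiD (x + star x)) amulDr scalerA -expr2.
rewrite sqrCi scaleN1r phiN !phi_i_hermitian // ?jj //.
by rewrite starD starK addrC.
Qed.

(** x y is half the sum of {x, y} = x y + y x^* and of x y - y x^*, which is
    {i x, y} divided by i. *)
Lemma bracket_multiplicative : {morph phi : x y / x ** y}.
Proof.
move=> x y; apply: (@lmulIn _ _ 2) => //; rewrite !mulr2n.
have plus := phi_jstar x y; have minus := phi_jstar ('i *: x) y.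
have jI : injective (amul j).
  move=> u v /(congr1 (amul j)); rewrite !amul_altl phi_i_sqr !amulNl !amul1x.
  exact: oppr_inj.
move: minus; rewrite jstar_i !phi_i jstar_phi_i => /jI minus.
have {plus minus} := congr2 +%R plus minus.
by rewrite -phiD /jstar addrACA subrr addr0 addrACA subrr addr0 phiD.
Qed.
End Multiplicativity.

(** * The theorem *)

Lemma qstar_ones (R : realType) (A : altStarAlgType R) m (x y : A) :
  qstar (nseq m aone ++ [:: x; y]) = jstar x y *+ (2 ^ m).
Proof.
have ones i (u : A) : u = aone *+ (2 ^ i) -> forall l,
    foldl (@jstar R A) u (nseq l aone ++ [:: x; y]) =
    jstar x y *+ (2 ^ (i + l).+1).
  move=> + l; elim: l i u => [|l IH] i u -> /=.
    by rewrite jstarMnl jstar1l jstarMnl jstarMnl -mulrnA addn0 expnS.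
  rewrite addnS -addSn; apply: IH.
  by rewrite jstarMnl jstar1l -mulrnA expnS.
case: m => [|m]; first by rewrite expn0.
by rewrite /= (ones 0%N) // add0n.
Qed.

Unset Implicit Arguments.

Theorem theorem2p2 (R : realType) (n : nat) (hn : (2 <= n)%N)
  (A A' : altStarAlgType R) (e1 e2 : A)
  (he1 : nontrivial_symmetric_idempotent e1)
  (he2 : nontrivial_symmetric_idempotent e2)
  (he12 : e2 = aone - e1)
  (phi : A -> A')
  (phi_bij : bijective phi)
  (phi_unital : phi aone = aone)
  (hA : forall e : A, e = e1 \/ e = e2 -> left_faithful_on e)
  (hA' : forall e : A, e = e1 \/ e = e2 -> left_faithful_on (phi e))
  (phi_q : forall a b xi : A, xi = aone \/ xi = e1 \/ xi = e2 ->
    phi (qstar (nseq (n - 2) xi ++ [:: a; b])) =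
    qstar (nseq (n - 2) (phi xi) ++ [:: phi a; phi b])) :
  star_ring_isomorphism phi.
Proof.
pose k := (2 ^ (n - 2))%N.
have k_gt0 : (0 < k)%N by rewrite expn_gt0.
have [e_sym _ _] := he1.
have phi_inj := bij_inj phi_bij.
have phi_surj y : exists x, phi x = y.
  by have [psi _ psiK] := phi_bij; exists (psi y).
have phi_jstar x y : phi (jstar x y *+ k) = jstar (phi x) (phi y) *+ k.
  by have := phi_q x y aone (or_introl erefl); rewrite phi_unital !qstar_ones.
have idemE a : idem e1 a = e1 \/ idem e1 a = e2.
  by rewrite he12; case: a; [left | right].
have phiD : {morph phi : x y / x + y}.
  apply: (bracket_additive k_gt0 phi_inj phi_surj phi_jstar e_sym) => a.
  exact: hA.
have phi_jstar1 : {morph phi : x y / jstar x y}.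
  have phiMn x m : phi (x *+ m) = phi x *+ m.
    elim: m => [|m IH]; last by rewrite !mulrS phiD IH.
    exact: (bracket_map0 phi_surj phi_jstar).
  by move=> x y; apply: (lmulIn k_gt0); rewrite -phiMn.
have faith a : left_faithful_on (phi (idem e1 a)) by exact: hA'.
split=> //.
- exact: (bracket_multiplicative phi_inj phi_surj phiD phi_unital phi_jstar1
    e_sym).
- exact: (bracket_star phiD phi_unital phi_jstar1).
Qed.
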